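(* Let $n, d\geq 1$ be positive integers. Then there is a positive integer $D\geq d$ and a clopen subset $M\subseteq F(2^{\mathbb{Z}^n})$ such that (1) for any distinct $x,y\in M$ in the same orbit, $\rho(x,y)\geq d$; (2) for any $1\leq i\leq n$ and any $x\in F(2^{\mathbb{Z}^n})$, there are non-negative integers $a,b\leq D$ such that $ae_i\cdot x\in M$ and $-be_i\cdot x\in M$.
   Context: $2^{\mathbb{Z}^n}=\{0,1\}^{\mathbb{Z}^n}$ carries the product topology (with $\{0,1\}$ discrete), and $\mathbb{Z}^n$ acts on it by the Bernoulli shift $(g\cdot x)(h)=x(g+h)$ for $g,h\in\mathbb{Z}^n$. The free part is $F(2^{\mathbb{Z}^n})=\{x\in 2^{\mathbb{Z}^n}: \forall g\in\mathbb{Z}^n\ (g\neq \overline{0}\Rightarrow g\cdot x\neq x)\}$, with the subspace topology; ''clopen'' means clopen in $F(2^{\mathbb{Z}^n})$. The orbit of $x$ is $[x]=\{g\cdot x: g\in\mathbb{Z}^n\}$. For $g\in\mathbb{Z}^n$, $\|g\|=\max_{1\leq i\leq n}|g(i)|$. For $x,y\in F(2^{\mathbb{Z}^n})$ in the same orbit, $\rho(x,y)=\|g\|$ where $g$ is the unique element of $\mathbb{Z}^n$ with $g\cdot x=y$. $e_1,\dots,e_n$ are the standard basis vectors of $\mathbb{Z}^n$. *)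

(* Defs.v *)
From mathcomp Require Import all_boot all_order all_algebra.
From mathcomp Require Import all_classical.
From mathcomp Require Import topology.

Set Implicit Arguments.
Unset Strict Implicit.
Unset Printing Implicit Defensive.

Import Order.TTheory GRing.Theory Num.Theory.

Local Open Scope classical_set_scope.
Local Open Scope ring_scope.

(* [{ptws _ -> _}] carries the product topology and [bool] the discrete one. *)
Definition bernoulli (n : nat) : topologicalType := {ptws 'rV[int]_n -> bool}.

Definition bshift (n : nat) (g : 'rV[int]_n) (x : bernoulli n) : bernoulli n :=
  fun h => x (g + h).

Definition free_part (n : nat) : set (bernoulli n) :=
  [set x | forall g : 'rV[int]_n, g != 0 -> bshift g x <> x].
Arguments free_part n : clear implicits.

Definition borbit (n : nat) (x : bernoulli n) : set (bernoulli n) :=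
  [set bshift g x | g in [set: 'rV[int]_n]].

Definition sup_norm (n : nat) (g : 'rV[int]_n) : nat :=
  \max_(i < n) `|g 0%R i|%N.

Definition basis_vec (n : nat) (i : 'I_n) : 'rV[int]_n := delta_mx 0 i.

(* The norm of the group element taking [x] to [y]; it is unique when [x] lies *)
(* in the free part (see [rho_bshift]). The value is junk when [y] is not in   *)
(* the orbit of [x].                                                           *)
Definition rho (n : nat) (x y : bernoulli n) : nat :=
  sup_norm (xget 0 [set g : 'rV[int]_n | bshift g x = y]).

Lemma bshift0 (n : nat) (x : bernoulli n) : bshift 0 x = x.
Proof. by apply/funext => h; rewrite /bshift add0r. Qed.

Lemma bshiftD (n : nat) (g h : 'rV[int]_n) (x : bernoulli n) :
  bshift (g + h) x = bshift g (bshift h x).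
Proof. by apply/funext => k; rewrite /bshift addrA (addrC h). Qed.

Lemma bshift_inj_free (n : nat) (x : bernoulli n) (g h : 'rV[int]_n) :
  free_part n x -> bshift g x = bshift h x -> g = h.
Proof.
move=> Fx gh; apply/eqP; rewrite -subr_eq0; apply/negPn/negP => /Fx; apply.
by rewrite addrC bshiftD gh -bshiftD addNr bshift0.
Qed.

Lemma rho_bshift (n : nat) (x : bernoulli n) (g : 'rV[int]_n) :
  free_part n x -> rho x (bshift g x) = sup_norm g.
Proof.
move=> Fx; rewrite /rho; case: xgetP => [h _ /= hg|/(_ g)]; last by case.
by rewrite (bshift_inj_free Fx hg).
Qed.

(* Main.v *)
Require Import Defs.
From mathcomp Require Import all_boot all_order all_algebra.
From mathcomp Require Import all_classical.
From mathcomp Require Import topology.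
From mathcomp Require Import zify ring.

Import Order.TTheory GRing.Theory Num.Theory.

Local Open Scope classical_set_scope.
Local Open Scope ring_scope.

Set Implicit Arguments.
Unset Strict Implicit.
Unset Printing Implicit Defensive.

(** Fix a clopen set P of markers that is s-separated in the sup norm and such
    that every point of the free part has a marker at sup-distance less than s.
    Around each marker draw the l1 ball of radius n * s; these balls cover every
    orbit.  Let V(x) be the set of g with |g|_1 <= n * s and g.x in P.  As long
    as x moves to h.x without coming close to the boundary of any ball, V is
    merely translated by - h.  Hence, for a fixed additive form
    radix(g) = sum_i d^i g_i with integer values, the number
    m(x) = min radix(V(x)) drops by exactly radix(h).  The set M consists of the
    points of the free part that lie deep inside or far outside every ball and
    for which N = d^n + 1 divides m(x).

    M is d-separated: if x and h.x are in M with |h| < d, then N divides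
    radix(h), and since the g_i act as base-d digits, |radix(h)| < N and
    radix(h) = 0 only for h = 0 ([radix_ndvd], [lattice_points_separated]).

    M meets every axis line often: moving by e_i changes m by d^i, a unit modulo
    N, so any N consecutive points of an axis line that avoid the ball boundaries
    contain a point of M ([lattice_points_axis]).  Such a run of N points exists
    because the faces of an l1 ball are transversal to all axes: an axis line
    stays in the thickened boundary of one ball for boundedly many steps,
    whatever s is, and near a stretch of the line of length at most s there are
    boundedly many markers, again independently of s.  So if s is large, the
    pigeonhole principle leaves a run of N points untouched
    ([axis_clear_block]).  With sup-norm balls this would fail: a line can run
    along a face that is parallel to it.

    P is obtained greedily from a countable cover of the free part by clopen
    sets that are disjoint from their small translates ([clopen_marker]).
    Clopenness of P and M is handled through local constancy: the value at x is
    determined, within the free part, by finitely many coordinates of x. *)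

(** * The sup norm and the l1 norm on Z^n *)

Lemma sup_norm_leP n (g : 'rV[int]_n) r :
  reflect (forall i, `|g 0%R i|%N <= r)%N (sup_norm g <= r)%N.
Proof.
rewrite /sup_norm; apply: (iffP (bigmax_leqP _ _ _)) => [h i|h i _]; last exact: h.
exact: h.
Qed.

Lemma sup_normN n (g : 'rV[int]_n) : sup_norm (- g) = sup_norm g.
Proof. by apply: eq_bigr => i _; rewrite mxE abszN. Qed.

Lemma sup_norm0 n : sup_norm (0 : 'rV[int]_n) = 0%N.
Proof. by apply/eqP; rewrite -leqn0; apply/sup_norm_leP => i; rewrite mxE. Qed.

Definition l1norm n (g : 'rV[int]_n) : nat := \sum_(i < n) `|g 0%R i|%N.

Lemma l1normD n (g h : 'rV[int]_n) : (l1norm (g + h) <= l1norm g + l1norm h)%N.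
Proof. by rewrite /l1norm -big_split leq_sum // => i _; rewrite mxE /=; lia. Qed.

Lemma l1normN n (g : 'rV[int]_n) : l1norm (- g) = l1norm g.
Proof. by apply: eq_bigr => i _; rewrite mxE abszN. Qed.

Lemma sup_norm_l1 n (g : 'rV[int]_n) : (sup_norm g <= l1norm g)%N.
Proof. by apply/sup_norm_leP => i; rewrite /l1norm (bigD1 i) //= leq_addr. Qed.

Lemma l1norm_sup n (g : 'rV[int]_n) r : (sup_norm g <= r)%N -> (l1norm g <= n * r)%N.
Proof.
move=> /sup_norm_leP gr; rewrite -[n in (n * _)%N]card_ord -sum_nat_const.
by apply: leq_sum => i _; exact: gr.
Qed.

Lemma l1norm_sub_axis n (g : 'rV[int]_n) i (t : nat) :
  l1norm (g - basis_vec i *+ t) =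
    (`|(g 0%R i - t%:Z)%R| + \sum_(j < n | j != i) `|g 0%R j|)%N.
Proof.
rewrite /l1norm (bigD1 i) //=; congr (_ + _)%N.
  by rewrite !mxE mulmxnE mxE !eqxx /= mulr1n; congr `|_|%N; lia.
by apply: eq_bigr => j ji; rewrite !mxE mulmxnE mxE (negPf ji) andbF mul0rn subr0.
Qed.

(** * Locally constant functions on the free part *)

Lemma free_part_shift n g (x : bernoulli n) :
  free_part n x -> free_part n (bshift g x).
Proof.
move=> Fx h h0 hg; apply: (Fx h h0).
have := congr1 (bshift (- g)) hg.
by rewrite -!bshiftD ?addrA (addrAC (- g)) addNr add0r bshift0.
Qed.

(** Coordinates are listed through the enumeration of Z^n given by [pickle_inv],
    so that patterns of a fixed length are words over bool and all patterns
    together form a countable type; indices that enumerate nothing read as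
    false. *)
Definition pattern n (k : nat) (x : bernoulli n) : seq bool :=
  mkseq (fun j => oapp x false (pickle_inv j)) k.

Lemma eq_patternP n k (x y : bernoulli n) :
  pattern k x = pattern k y <-> forall h : 'rV[int]_n, (pickle h < k)%N -> x h = y h.
Proof.
split=> [exy h hk|exy].
  have := congr1 (nth false ^~ (pickle h)) exy.
  by rewrite !nth_mkseq // pickleK_inv.
apply/eq_in_map => j; rewrite mem_iota /= => jk.
have := pickle_invK (T := 'rV[int]_n) j.
by case: (pickle_inv j) => //= h hj; apply: exy; rewrite hj.
Qed.

Lemma pattern_le n k l (x y : bernoulli n) :
  (k <= l)%N -> pattern l x = pattern l y -> pattern k x = pattern k y.
Proof.
move=> kl /eq_patternP exy; apply/eq_patternP => h hk.
by apply: exy; exact: leq_trans kl.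
Qed.

(** Continuity on the free part towards a discrete target; for [set]-valued [f],
    i.e. T = Prop, this says that the set is relatively clopen. *)
Definition locally_constant n (T : Type) (f : bernoulli n -> T) :=
  forall x, free_part n x -> exists k, forall y, free_part n y ->
    pattern k y = pattern k x -> f y = f x.

Lemma nbhs_pattern n k (x : bernoulli n) :
  nbhs x [set y | pattern k y = pattern k x].
Proof.
elim: k => [|k IHk]; first by apply: filterS filterT.
have evC (h : 'rV[int]_n) : nbhs x [set y : bernoulli n | y h = x h].
  exact: (@proj_continuous _ (fun=> bool) h x _ (discrete_set1 (x h))).
have : nbhs x
    [set y : bernoulli n | oapp y false (pickle_inv k) = oapp x false (pickle_inv k)].
  case: (pickle_inv k) => [h|] /=; first exact: evC.
  by apply: filterS filterT.
move/(filterI IHk); apply: filterS => y [/= ek eh].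
have pS (z : bernoulli n) :
    pattern k.+1 z = rcons (pattern k z) (oapp z false (pickle_inv k)).
  exact: mkseqS.
by rewrite /= !pS ek eh.
Qed.

Lemma locally_constant_clopen n (M : set (bernoulli n)) :
  locally_constant M -> @clopen (subspace (free_part n)) M.
Proof.
move=> Mlc.
have openW (W : set (bernoulli n)) : locally_constant W ->
    open (W : set (subspace (free_part n))).
  move=> Wlc; apply/open_subspaceP; exists (W `|` ~` free_part n)^°.
    exact: open_interior.
  apply/seteqP; split=> x [Wx Fx].
    by split=> //; case: (interior_subset Wx).
  split=> //; have [k kP] := Wlc x Fx.
  apply: filterS (nbhs_pattern k x) => y /= yx.
  have [Fy|nFy] := pselect (free_part n y); last by right.
  by left; rewrite (kP y Fy yx).
split; first exact: openW.
rewrite -openC; apply: openW => x /Mlc[k kP]; exists k => y Fy yx.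
by rewrite /setC /= (kP y Fy yx).
Qed.

(** The first k coordinates of [bshift g x] are finitely many coordinates of x,
    hence contained in a long enough initial pattern of x. *)
Lemma locally_constant_shift n T (f : bernoulli n -> T) g :
  locally_constant f -> locally_constant (fun x => f (bshift g x)).
Proof.
move=> flc x Fx; have [k kP] := flc _ (free_part_shift (g := g) Fx).
pose c j :=
  oapp (fun h => (pickle (g + h : 'rV[int]_n)).+1) 0%N (@pickle_inv 'rV[int]_n j).
exists (\max_(j < k) c j)%N => y Fy /eq_patternP yx.
apply: kP; first exact: free_part_shift.
apply/eq_patternP => h hk; apply: yx.
have := @leq_bigmax _ (fun j : 'I_k => c j) (Ordinal hk).
by rewrite [c (Ordinal hk)]/c /= pickleK_inv.
Qed.

Definition ball_seq n (r : nat) : seq 'rV[int]_n :=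
  [seq \row_i ((f i)%:Z - r%:Z) | f : {ffun 'I_n -> 'I_(r + r).+1}].

Lemma sup_norm_ball n (g : 'rV[int]_n) r : (sup_norm g <= r)%N -> g \in ball_seq n r.
Proof.
move=> /sup_norm_leP gr; apply/mapP.
exists [ffun i => inord `|(g 0%R i + r%:Z)%R|%N]; first by rewrite mem_enum.
apply/rowP => i; rewrite mxE ffunE; move: (g 0 i) (gr i) => z zr.
by rewrite inordK; lia.
Qed.

(** A single pattern length works for all shifts in a ball, since the ball is
    finite. *)
Lemma locally_constant_ball n T (f : bernoulli n -> T) r :
  locally_constant f ->
  forall x, free_part n x -> exists k, forall y, free_part n y ->
    pattern k y = pattern k x ->
    forall g, (sup_norm g <= r)%N -> f (bshift g y) = f (bshift g x).
Proof.
move=> flc x Fx.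
suff [k kP] : exists k, forall y, free_part n y -> pattern k y = pattern k x ->
    forall g, g \in ball_seq n r -> f (bshift g y) = f (bshift g x).
  by exists k => y Fy yx g /sup_norm_ball; exact: kP.
elim: (ball_seq n r) => [|g s [k kP]]; first by exists 0%N.
have [l lP] := locally_constant_shift g flc Fx.
exists (maxn k l) => y Fy yx h; rewrite inE => /orP[/eqP->|hs].
  by apply: lP => //; apply: pattern_le yx; exact: leq_maxr.
by apply: kP => //; apply: pattern_le yx; exact: leq_maxl.
Qed.

(** The tool that makes all later sets clopen: if membership of x in a
    set depends only on the values of a locally constant [f] at the points
    [bshift g x] with g in a ball, then the set is locally constant. *)
Lemma locally_constant_shifts n T (f : bernoulli n -> T) r (Q : set (bernoulli n)) :
  locally_constant f ->
  (forall x y, (forall g, (sup_norm g <= r)%N -> f (bshift g x) = f (bshift g y)) ->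
    Q x -> Q y) ->
  locally_constant Q.
Proof.
move=> flc fQ x Fx; have [k kP] := locally_constant_ball r flc Fx.
exists k => y Fy yx; have fyx := kP y Fy yx.
by apply/propext; split; apply: fQ => g gr; rewrite fyx.
Qed.

Lemma locally_constant_pattern n k : locally_constant (@pattern n k).
Proof. by move=> x _; exists k. Qed.

Lemma locally_constant_pair n T U (f : bernoulli n -> T) (h : bernoulli n -> U) :
  locally_constant f -> locally_constant h -> locally_constant (fun x => (f x, h x)).
Proof.
move=> flc hlc x Fx; have [k kP] := flc x Fx; have [l lP] := hlc x Fx.
exists (maxn k l) => y Fy yx; congr pair.
  by apply: kP => //; apply: pattern_le yx; exact: leq_maxl.
by apply: lP => //; apply: pattern_le yx; exact: leq_maxr.
Qed.

(** * Clopen marker sets *)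

(** For a word w, the clopen set of points that start with w while none of their
    nonzero translates by vectors of norm less than s does: it is disjoint from
    these translates.  The option type lets [pickle_inv] enumerate all of these
    sets, with an empty set at the unused indices. *)
Definition seed n s (o : option (seq bool)) : set (bernoulli n) :=
  [set x | exists2 w, o = Some w & pattern (size w) x = w /\
    forall g, g != 0 -> (sup_norm g < s)%N -> pattern (size w) (bshift g x) <> w].

Lemma seed_disjoint n s o (x : bernoulli n) g :
  seed s o x -> seed s o (bshift g x) -> (sup_norm g < s)%N -> g = 0.
Proof.
move=> [w ow [_ wg]] [v]; rewrite ow => -[<-] [wgx _] gs.
by apply/eqP/negPn/negP => /wg; exact.
Qed.

Lemma seed_locally_constant n s o : locally_constant (@seed n s o).
Proof.
case: o => [w|]; last first.
  by move=> x _; exists 0%N => y _ _; apply/propext; split=> -[].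
apply: (@locally_constant_shifts _ _ (@pattern n (size w)) s).
  exact: locally_constant_pattern.
move=> x y xy [_ [<-] [wx wg]]; exists w => //; split.
  by rewrite -{2}wx; have := xy 0; rewrite !bshift0 sup_norm0 => ->.
by move=> g g0 gs; rewrite -xy ?(ltnW gs) //; exact: wg.
Qed.

(** By freeness x differs from each of its finitely many small translates at some
    coordinate, so a long enough pattern of x separates it from all of them. *)
Lemma seed_cover n s (x : bernoulli n) :
  free_part n x -> exists w, seed s (Some w) x.
Proof.
move=> Fx.
suff [k kP] : exists k, forall g, g \in ball_seq n s -> g != 0 ->
    pattern k (bshift g x) <> pattern k x.
  have sk : size (pattern k x) = k by rewrite size_mkseq.
  exists (pattern k x), (pattern k x); rewrite ?sk //; split=> // g g0 gs.
  by apply: kP => //; apply: sup_norm_ball; exact: ltnW.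
elim: (ball_seq n s) => [|g t [k kP]]; first by exists 0%N.
have [l lP] : exists l, g != 0 -> pattern l (bshift g x) <> pattern l x.
  apply: contrapT => /forallNP nl; case: (eqVneq g 0) => [g0|g0].
    by apply: (nl 0%N); rewrite g0 eqxx.
  apply: (Fx g g0); apply/funext => h; apply: contrapT => ne.
  by apply: (nl (pickle h).+1) => _ /eq_patternP/(_ h (ltnSn _)).
exists (maxn k l) => h; rewrite inE => /orP[/eqP->|ht] h0 e.
  by apply: (lP h0); apply: pattern_le e; exact: leq_maxr.
by apply: (kP h ht h0); apply: pattern_le e; exact: leq_maxl.
Qed.

(** At stage m the points of the m-th seed set enter, unless a point at
    distance less than s has entered before.  Two points of the same seed set never
    compete, which is why separation is preserved without further choices. *)
Fixpoint greedy n s m : set (bernoulli n) :=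
  if m is m'.+1 then
    [set x | greedy s m' x \/ seed s (pickle_inv m') x /\
       forall g, (sup_norm g < s)%N -> ~ greedy s m' (bshift g x)]
  else set0.

Lemma greedy_locally_constant n s m : locally_constant (@greedy n s m).
Proof.
elim: m => [|m IHm]; first by move=> x _; exists 0%N.
apply: (@locally_constant_shifts _ _
  (fun x => (greedy s m x, seed s (pickle_inv m) x)) s).
  by apply: locally_constant_pair => //; exact: seed_locally_constant.
move=> x y xy; have [gxy sxy] : (greedy s m x, seed s (pickle_inv m) x)
    = (greedy s m y, seed s (pickle_inv m) y).
  by have := xy 0; rewrite !bshift0 sup_norm0; exact.
move=> [gx|[sx ngx]]; [left|right].
  by rewrite -gxy.
split; first by rewrite -sxy.
by move=> g gs; have [<- _] := xy g (ltnW gs); exact: ngx.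
Qed.

Lemma greedy_le n s m m' : (m <= m')%N -> @greedy n s m `<=` @greedy n s m'.
Proof.
by elim: m' => [|m' IH]; rewrite leq_eqVlt => /orP[/eqP->//|//] /IH h x /h; left.
Qed.

Lemma greedy_separated n s m (x : bernoulli n) g :
  greedy s m x -> greedy s m (bshift g x) -> (sup_norm g < s)%N -> g = 0.
Proof.
elim: m => [//|m IHm] /= [gx|[sx ngx]] [ggx|[sgx nggx]] gs.
- exact: IHm.
- by have := nggx (- g); rewrite sup_normN -bshiftD addNr bshift0 => /(_ gs).
- by case: (ngx g gs).
- exact: seed_disjoint sx sgx gs.
Qed.

(** The union of the greedy stages.  It is maximal because each point is treated
    at the stage of a seed set containing it.  It is locally constant because
    later stages cannot change the decision: on the m-th seed set it coincides
    with stage m.+1. *)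
Lemma clopen_marker n s : (0 < s)%N -> exists P : set (bernoulli n),
  [/\ locally_constant P,
      forall x g, P x -> P (bshift g x) -> (sup_norm g < s)%N -> g = 0
    & forall x, free_part n x -> exists2 g, (sup_norm g < s)%N & P (bshift g x)].
Proof.
move=> s0; pose P := \bigcup_m @greedy n s m.
have Psep x g : P x -> P (bshift g x) -> (sup_norm g < s)%N -> g = 0.
  move=> [m _ gx] [m' _ ggx]; apply: (@greedy_separated _ _ (maxn m m') x).
    by apply: greedy_le gx; exact: leq_maxl.
  by apply: greedy_le ggx; exact: leq_maxr.
exists P; split=> //.
  move=> x Fx; have [w sw] := seed_cover s Fx; set m := pickle w.
  have PE y : seed s (Some w) y -> P y = greedy s m.+1 y.
    move=> sy; apply/propext; split=> [Py|gy]; last by exists m.+1.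
    apply: contrapT => /= /not_orP[ngy]; rewrite pickleK_inv => nsy; apply: nsy.
    split=> // g gs ggy; have g0 : g = 0 by apply: (Psep y) => //; exists m.
    by apply: ngy; rewrite g0 bshift0 in ggy.
  have [k kP] := locally_constant_pair (@seed_locally_constant n s (Some w))
    (@greedy_locally_constant n s m.+1) Fx.
  exists k => y Fy yx; have [se ge] := kP y Fy yx.
  by rewrite !PE //= se.
move=> x Fx; have [w sw] := seed_cover s Fx; set m := pickle w.
have [[g gs gg]|ng] :=
  pselect (exists2 g, (sup_norm g < s)%N & greedy s m (bshift g x)).
  by exists g => //; exists m.
exists 0; first by rewrite sup_norm0.
rewrite bshift0; exists m.+1 => //; right; rewrite pickleK_inv; split=> // g gs gg.
by apply: ng; exists g.
Qed.

(** * Axis lines cross few l1 shells *)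

Lemma divn_eq_dist a b s :
  (0 < s)%N -> (a %/ s = b %/ s)%N -> (`|(a%:Z - b%:Z)%R| < s)%N.
Proof.
move=> s0 eab; rewrite (divn_eq a s) (divn_eq b s) eab.
have := ltn_pmod a s0; have := ltn_pmod b s0.
by move: (a %% s)%N (b %% s)%N (b %/ s * s)%N => x y z; lia.
Qed.

(** One more than the number of possible data of a shell crossing in
    [axis_clear_block]: a cell of side s for the marker, the side of the marker
    on which the crossing occurs, and the position within the shell. *)
Definition block_count n c : nat := ((n + n + 2).+1 ^ n * (2 * (c + c).+1)).+1.

(** Cut the positive axis into B consecutive blocks of length N and suppose
    that every block has a point w.2 within c of the boundary of the l1 ball
    around some w.1 in Q.  Along the line, the l1 distance to w.1 is
    |w.1_i - t| plus a constant, so that t is determined by w.1, by the sign of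
    w.1_i - t and by the value of the distance, which lies in a window of width
    2c.  Moreover w.1 lies in a box of side proportional to s, hence is
    determined, by separation, by its cell of side s, and the number of cells
    does not depend on s.  There are fewer such data than blocks. *)
Lemma axis_clear_block n N c s (Q : set 'rV[int]_n) (i : 'I_n)
    (B := block_count n c) :
  (0 < N)%N ->
  (forall p q, Q p -> Q q -> (sup_norm (q - p) < s)%N -> q = p) ->
  (c + N * B <= s)%N ->
  exists u, (u < B)%N /\ forall j q, (j < N)%N -> Q q ->
    (l1norm (q - basis_vec i *+ (u * N + j)) <= n * s + c)%N ->
    (l1norm (q - basis_vec i *+ (u * N + j)) + c <= n * s)%N.
Proof.
move=> N0 Qsep sB; apply: contrapT => /forallNP no.
have s0 : (0 < s)%N by have : (0 < B)%N := isT; nia.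
have /choice[w wP] : forall u : 'I_B, exists w : 'rV[int]_n * nat,
    [/\ Q w.1, (u * N <= w.2 < u * N + N)%N
      & (l1norm (w.1 - basis_vec i *+ w.2)%R <= n * s + c)%N &&
        (n * s < l1norm (w.1 - basis_vec i *+ w.2)%R + c)%N].
  move=> u; have /not_andP[|] := no u; first by rewrite ltn_ord.
  move=> /existsNP[j] /existsNP[q] /not_implyP[jN] /not_implyP[Qq].
  move=> /not_implyP[le1 /negP]; rewrite -ltnNge => lt2.
  exists (q, (u * N + j)%N); split => //=; first lia.
  by rewrite /= le1.
have wbound u : forall k, (`|(w u).1 0%R k|%N <= (n + 1) * s)%N.
  have [_ tu /andP[le1 _]] := wP u => k.
  have t_s : ((w u).2 + c <= s)%N by have := ltn_ord u; nia.
  have : (sup_norm (w u).1 <= (n + 1) * s)%N; last by move=> /sup_norm_leP.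
  apply: leq_trans (sup_norm_l1 _) _.
  rewrite -[X in l1norm X](subrK (basis_vec i *+ (w u).2)).
  apply: leq_trans (l1normD _ _) _.
  suff : l1norm (basis_vec i *+ (w u).2) = (w u).2.
    move=> ->.
    by apply: leq_trans (leq_add le1 (leqnn _)) _; rewrite mulnDl mul1n; lia.
  have := l1norm_sub_axis 0 i (w u).2; rewrite sub0r l1normN => ->.
  rewrite big1 ?addn0; last by move=> j _; rewrite mxE.
  by rewrite mxE sub0r abszN.
(* All relevant markers have coordinates of absolute value at most (n + 1) * s,
   so after translation their cells of side s are numbered 0, ..., 2n + 2 in each
   direction. *)
pose dist u := l1norm ((w u).1 - basis_vec i *+ (w u).2).
pose f (u : 'I_B) : {ffun 'I_n -> 'I_(n + n + 2).+1} * bool * 'I_(c + c).+1 :=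
  (finfun (fun k => inord (`|((w u).1 0%R k + ((n + 1) * s)%N%:Z)%R| %/ s)%N),
   (w u).1 0%R i < (w u).2%:Z,
   inord (n * s + c - dist u)%N).
have finj : injective f.
  move=> u v fuv.
  have /ffunP cell := congr1 (fun z => z.1.1) fuv.
  have /= sgn := congr1 (fun z => z.1.2) fuv.
  have /= duv := congr1 snd fuv.
  have [Qu tu du] := wP u; have [Qv tv dv] := wP v.
  have wuv : (w u).1 = (w v).1.
    apply: Qsep => //; rewrite -(prednK s0) ltnS; apply/sup_norm_leP => k.
    have := cell k; rewrite /= !ffunE => /(congr1 val) /=.
    have ub := wbound u k; have vb := wbound v k.
    rewrite !mxE; move: ((w u).1 0 k) ((w v).1 0 k) ub vb => p q ub vb.
    have le2 (z : int) : (`|z| <= (n + 1) * s)%N ->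
        (`|(z + ((n + 1) * s)%N%:Z)%R| %/ s < (n + n + 2).+1)%N.
      by move=> zb; rewrite ltn_divLR // !mulSn !mulnDl in zb *; lia.
    rewrite !inordK ?le2 // => /(divn_eq_dist s0).
    move: ((n + 1) * s)%N ub vb => m ub vb.
    have absz_shift (z : int) :
      (`|z| <= m)%N -> `|(z + m%:Z)%R|%N = z + m%:Z :> int by lia.
    by rewrite !absz_shift // opprD addrACA subrr addr0; lia.
  have edist : dist u = dist v.
    move: du dv; rewrite -/(dist u) -/(dist v) => du dv.
    by move/(congr1 val): duv; rewrite /= !inordK; lia.
  move: edist sgn; rewrite /dist !l1norm_sub_axis wuv => /addIn tuv sgn.
  have {sgn tuv} : (w u).2 = (w v).2 by move: sgn tuv; case: ltP; case: ltP; lia.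
  move=> wuv2; apply/val_inj; apply/eqP; rewrite /= eqn_leq.
  move: tu tv; rewrite wuv2 => tu tv; apply/andP; split; nia.
have := leq_card f finj.
by rewrite !card_prod card_ffun !card_ord card_bool /B /block_count mulnA ltnn.
Qed.

(** * The radix form *)

(** Base-d digits of arbitrary sign: the bound is the geometric sum
    (d - 1)(1 + d + ... + d^(n-1)) = d^n - 1. *)
Lemma digit_sum_bound (d n : nat) (v : 'I_n -> int) :
  (0 < d)%N -> (forall i, `|v i|%N < d)%N ->
  `|\sum_(i < n) v i * d%:Z ^+ i| < d%:Z ^+ n.
Proof.
move=> d0; elim: n v => [|n IHn] v vd; first by rewrite big_ord0.
rewrite big_ord_recr /=; apply: le_lt_trans (ler_normD _ _) _.
have /IHn lo : forall i, (`|v (widen_ord (leqnSn n) i)| < d)%N.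
  by move=> i; exact: vd.
have hi : `|v ord_max| <= d%:Z - 1 by have := vd ord_max; lia.
rewrite normrM (ger0_norm (exprn_ge0 _ _)) // exprS.
have := ler_wpM2r (exprn_ge0 n (isT : 0 <= d%:Z)) hi.
rewrite mulrBl mul1r; move: lo; set S := `|_|; set T := `|_| * _; lia.
Qed.

(** The top digit must vanish, as its contribution would exceed the bound on the
    sum of the lower ones. *)
Lemma digit_sum_eq0 (d n : nat) (v : 'I_n -> int) :
  (0 < d)%N -> (forall i, `|v i|%N < d)%N ->
  \sum_(i < n) v i * d%:Z ^+ i = 0 -> forall i, v i = 0.
Proof.
move=> d0; elim: n v => [|n IHn] v vd.
  by move=> _ i; have := ltn_ord i; rewrite ltn0.
have vd' : forall i, (`|v (widen_ord (leqnSn n) i)| < d)%N.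
  by move=> i; exact: vd.
have := digit_sum_bound d0 vd'; rewrite big_ord_recr /= => lo e0.
have top0 : v ord_max = 0.
  apply/eqP/negPn/negP => v0; move: lo.
  rewrite (eqP (_ : \sum_(i < n) _ == - (v ord_max * d%:Z ^+ n))); last first.
    by rewrite -addr_eq0 e0.
  rewrite normrN normrM (ger0_norm (exprn_ge0 _ _)) // ltNge => /negP; apply.
  by rewrite ler_peMl ?exprn_ge0 //; lia.
move: e0; rewrite top0 mul0r addr0 => /(IHn _ vd') lo0 i.
have : (exists j, i = widen_ord (leqnSn n) j) \/ i = ord_max.
  have [ij|ij] := ltnP i n; [left|right].
    by exists (Ordinal ij); apply/val_inj.
  by apply/val_inj => /=; have := ltn_ord i; lia.
by case=> [[j ->]|->].
Qed.

(** The kernel of this form modulo d^n + 1 is a lattice in Z^n that avoids the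
    nonzero vectors of norm less than d and meets all axis lines: [radix_ndvd] and
    [axis_residue]. *)
Definition radix (d n : nat) (g : 'rV[int]_n) : int :=
  \sum_(i < n) g 0 i * d%:Z ^+ i.

Lemma radixD d n (g h : 'rV[int]_n) : radix d (g + h) = radix d g + radix d h.
Proof. by rewrite /radix -big_split; apply: eq_bigr => i _; rewrite mxE mulrDl. Qed.

Lemma radix_axis d n (i : 'I_n) t : radix d (basis_vec i *+ t) = t%:Z * d%:Z ^+ i.
Proof.
rewrite /radix (bigD1 i) //= big1 ?addr0.
  by rewrite mulmxnE mxE !eqxx /= mulr1n natz.
by move=> j ji; rewrite mulmxnE mxE (negPf ji) andbF mul0rn mul0r.
Qed.

Lemma radix_ndvd d n (h : 'rV[int]_n) :
  (0 < d)%N -> (sup_norm h < d)%N -> ((d ^ n).+1%:Z %| radix d h)%Z -> h = 0.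
Proof.
move=> d0 hd dvd.
have hi i : (`|h 0%R i| < d)%N.
  by apply: leq_ltn_trans hd; move/sup_norm_leP: (leqnn (sup_norm h)); exact.
have lt := digit_sum_bound d0 hi.
suff p0 : radix d h = 0.
  by apply/rowP => i; rewrite mxE; exact: (digit_sum_eq0 d0 hi p0).
apply/eqP; rewrite -absz_eq0; apply/negPn/negP; rewrite -lt0n => p0.
have := dvdn_leq p0 dvd; rewrite leqNgt => /negP; apply.
have : (`|radix d h|%N%:Z < (d ^ n)%N%:Z) by rewrite abszE -natz natrX natz.
rewrite ltz_nat absz_nat; lia.
Qed.

(** d is invertible modulo d^n + 1. *)
Lemma axis_residue d n (i : nat) (z : int) (N := (d ^ n).+1) :
  (0 < n)%N -> exists2 j : nat, (j < N)%N & (N%:Z %| z - j%:Z * d%:Z ^+ i)%Z.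
Proof.
move=> n0.
have co : coprimez (d%:Z ^+ i) N%:Z.
  rewrite coprimezXl // coprimezE !absz_nat /N.
  by rewrite -(prednK n0) expnS -addn1 mulnC /coprime gcdnMDl gcdn1.
have [[u v] uv] := coprimezP _ _ co.
exists `|((z * u) %% N%:Z)%Z|%N.
  by have := @ltz_mod (z * u) N%:Z isT; have := @modz_ge0 (z * u) N%:Z isT; lia.
rewrite gez0_abs ?modz_ge0 //.
have -> : z - ((z * u) %% N)%Z * d%:Z ^+ i =
    (z * v + (z * u %/ N)%Z * d%:Z ^+ i) * N%:Z.
  rewrite /= in uv; have := divz_eq (z * u) N%:Z; move: uv; set e := d%:Z ^+ i.
  move: ((z * u) %% N)%Z ((z * u) %/ N)%Z => r q uv zu.
  have -> : r = z * u - q * N%:Z by rewrite zu; ring.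
  rewrite -[X in X - _]mulr1 -uv; ring.
exact: dvdz_mull.
Qed.

(** * Copies of the lattice inside the regions *)

Lemma seq_argmin (T : eqType) (t : seq T) (A : T -> Prop) (f : T -> int) :
  (exists2 g, g \in t & A g) ->
  exists g, [/\ g \in t, A g & forall h, h \in t -> A h -> f g <= f h].
Proof.
elim: t => [|g t IHt]; first by case.
move=> [h0 h0t Ah0].
have [/IHt[m [mt Am mmin]]|nt] := pselect (exists2 h, h \in t & A h).
  have [[Ag gm]|ngm] := pselect (A g /\ f g <= f m).
    exists g; split=> //; first exact: mem_head.
    move=> h; rewrite inE => /orP[/eqP->//|ht Ah].
    by apply: le_trans gm _; exact: mmin.
  exists m; split=> //; first by rewrite inE mt orbT.
  move=> h; rewrite inE => /orP[/eqP-> Ag|]; last exact: mmin.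
  by rewrite leNgt; apply/negP => /ltW gm; apply: ngm.
exists h0; split=> // h ht Ah.
have only k : k \in g :: t -> A k -> k = g.
  by rewrite inE => /orP[/eqP//|kt Ak]; case: nt; exists k.
by rewrite (only h) // (only h0).
Qed.

(** No ball of radius r around a marker has its boundary within l1 distance c of
    x: every marker is far outside or deep inside the ball of radius r around
    x. *)
Definition off_shells n (c r : nat) (P : set (bernoulli n)) (x : bernoulli n) :=
  forall g, (l1norm g <= r + c)%N -> P (bshift g x) -> (l1norm g + c <= r)%N.

(** The marker near x whose radix value is least; it plays the role of a local
    origin.  It need not be unique, but its radix value is. *)
Definition anchor n (d r : nat) (P : set (bernoulli n)) (x : bernoulli n) g :=
  [/\ (l1norm g <= r)%N, P (bshift g x)
    & forall h, (l1norm h <= r)%N -> P (bshift h x) -> radix d g <= radix d h].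

(** Moving from x to [bshift h x] without crossing a shell, no marker enters or
    leaves the ball, and the radix form is additive; so the minimum is attained at
    the same marker, whose position relative to the moved point is g - h. *)
Lemma anchor_shift n d c r P (x : bernoulli n) g h :
  off_shells c r P x -> off_shells c r P (bshift h x) -> (l1norm h <= c)%N ->
  anchor d r P x g -> anchor d r P (bshift h x) (g - h).
Proof.
move=> cx chx hc [gr Pg gmin].
have grc : (l1norm g + c <= r)%N.
  by apply: cx => //; exact: leq_trans gr (leq_addr _ _).
split=> [||k kr Pk].
- apply: leq_trans (l1normD _ _) _; rewrite l1normN.
  by apply: leq_trans grc; rewrite leq_add2l.
- by rewrite -bshiftD subrK.
have krc : (l1norm k + c <= r)%N.
  by apply: chx => //; exact: leq_trans kr (leq_addr _ _).
have : radix d g <= radix d (k + h).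
  apply: gmin; last by rewrite bshiftD.
  by apply: leq_trans (l1normD _ _) _; apply: leq_trans krc; rewrite leq_add2l.
by rewrite -[g in radix d g](subrK h) !radixD lerD2r.
Qed.

Lemma anchor_radix n d r P (x : bernoulli n) g h :
  anchor d r P x g -> anchor d r P x h -> radix d g = radix d h.
Proof.
by move=> [gr Pg gmin] [hr Ph hmin]; apply/le_anti; rewrite gmin ?hmin.
Qed.

Lemma anchor_exists n d r P (x : bernoulli n) g :
  (l1norm g <= r)%N -> P (bshift g x) -> exists h, anchor d r P x h.
Proof.
move=> gr Pg.
have mem h : (l1norm h <= r)%N -> h \in ball_seq n r.
  by move=> hr; apply: sup_norm_ball; exact: leq_trans (sup_norm_l1 h) hr.
have [|h [_ [hr Ph] hmin]] := @seq_argmin _ (ball_seq n r)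
  (fun h => (l1norm h <= r)%N /\ P (bshift h x)) (@radix d n).
  by exists g => //; exact: mem.
by exists h; split=> // k kr Pk; apply: hmin => //; exact: mem.
Qed.

Definition lattice_points n (d c r : nat) (P : set (bernoulli n)) :
  set (bernoulli n) :=
  [set x | off_shells c r P x /\
    exists2 g, anchor d r P x g & ((d ^ n).+1%:Z %| radix d g)%Z].

Lemma lattice_points_locally_constant n d c r (P : set (bernoulli n)) :
  locally_constant P -> locally_constant (lattice_points d c r P).
Proof.
move=> Plc; apply: (@locally_constant_shifts _ _ P (r + c)) => // x y xy.
have Pxy g : (l1norm g <= r + c)%N -> P (bshift g x) = P (bshift g y).
  by move=> gr; apply: xy; exact: leq_trans (sup_norm_l1 g) gr.
have Pxy' g : (l1norm g <= r)%N -> P (bshift g x) = P (bshift g y).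
  by move=> gr; apply: Pxy; exact: leq_trans gr (leq_addr _ _).
move=> [cx [g [gr Pg gmin] gdvd]]; split.
  by move=> h hr; rewrite -Pxy //; exact: cx.
exists g => //; split=> //; first by rewrite -Pxy'.
by move=> h hr; rewrite -Pxy' //; exact: gmin.
Qed.

Lemma lattice_points_separated n d r P (x : bernoulli n) h : (0 < d)%N ->
  lattice_points d (n * d) r P x -> lattice_points d (n * d) r P (bshift h x) ->
  (sup_norm h < d)%N -> h = 0.
Proof.
move=> d0 [cx [g ag gdvd]] [chx [k ak kdvd]] hd.
have hc := l1norm_sup (ltnW hd).
apply: (radix_ndvd d0 hd).
have := anchor_radix (anchor_shift cx chx hc ag) ak.
move=> /(congr1 (+%R (radix d h))); rewrite -radixD addrC subrK => egk.
by rewrite egk in gdvd; rewrite -[radix d h](addrK (radix d k)); exact: rpredB.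
Qed.

(** On a run of N shell-free points of the axis line the anchor remains the same
    marker, while its radix value decreases by d^i at each step and thus takes the
    value 0 modulo N. *)
Lemma lattice_points_axis n d (i : 'I_n) c s P (x : bernoulli n)
  (N := (d ^ n).+1) (B := block_count n c) :
  (0 < c)%N -> (c + N * B <= s)%N ->
  (forall x g, P x -> P (bshift g x) -> (sup_norm g < s)%N -> g = 0) ->
  (forall x, free_part n x -> exists2 g, (sup_norm g < s)%N & P (bshift g x)) ->
  free_part n x ->
  exists2 a, (a < N * B)%N &
    lattice_points d c (n * s) P (bshift (basis_vec i *+ a) x).
Proof.
move=> c0 sB Psep Pcov Fx; set e := basis_vec i.
have [|u [uB clearu]] :=
  @axis_clear_block n N c s [set q | P (bshift q x)] i isT _ sB.
  move=> p q /= Pp Pq pq; apply/eqP; rewrite -subr_eq0; apply/eqP.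
  by apply: (Psep (bshift p x)) => //; rewrite -bshiftD subrK.
pose y j := bshift (e *+ (u * N + j)) x.
have yclear j : (j < N)%N -> off_shells c (n * s) P (y j).
  move=> jN g; rewrite /y -bshiftD => gr Pg.
  by have := clearu j (g + e *+ (u * N + j)) jN Pg; rewrite addrK; exact.
have [g0 ag0] : exists g, anchor d (n * s) P (y 0%N) g.
  have [g gs Pg] := Pcov (y 0%N) (free_part_shift Fx).
  exact: anchor_exists (l1norm_sup (ltnW gs)) Pg.
have l1e : (l1norm e <= c)%N.
  have := l1norm_sub_axis 0 i 1; rewrite sub0r l1normN mulr1n => ->.
  rewrite big1 ?addn0; last by move=> j _; rewrite mxE.
  by rewrite mxE.
have agj j : (j < N)%N -> anchor d (n * s) P (y j) (g0 - e *+ j).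
  elim: j => [|j IHj] jN; first by rewrite mulr0n subr0.
  have yS : y j.+1 = bshift e (y j) by rewrite /y -bshiftD addnS mulrS.
  rewrite yS mulrSr opprD addrA; apply: (@anchor_shift _ _ c) => //.
  - by apply: yclear; exact: ltnW.
  - by rewrite -yS; exact: yclear.
  - by apply: IHj; exact: ltnW.
have n0 : (0 < n)%N by exact: leq_ltn_trans (leq0n i) (ltn_ord i).
have [j jN jdvd] := axis_residue d i (radix d g0) n0.
exists (u * N + j)%N.
  rewrite [(N * B)%N]mulnC; apply: leq_trans (leq_mul uB (leqnn N)).
  by rewrite mulSn addnC ltn_add2r.
split; first exact: yclear.
exists (g0 - e *+ j); first exact: agj.
suff -> : radix d (g0 - e *+ j) = radix d g0 - j%:Z * d%:Z ^+ i by [].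
by apply/eqP; rewrite eq_sym subr_eq -radix_axis -radixD subrK.
Qed.

(** * The theorem *)

Theorem theorem1p2 (n d : nat) (hn : (1 <= n)%N) (hd : (1 <= d)%N) :
  exists (D : nat) (M : set (bernoulli n)),
    [/\ (0 < D)%N /\ (d <= D)%N,
        M `<=` free_part n /\ @clopen (subspace (free_part n)) M,
        forall x y : bernoulli n,
          M x -> M y -> x <> y -> borbit x y -> (d <= rho x y)%N
      & forall (i : 'I_n) (x : bernoulli n), free_part n x ->
          exists a b : nat,
            [/\ (a <= D)%N, (b <= D)%N,
                M (bshift (basis_vec i *+ a) x)
              & M (bshift (- (basis_vec i *+ b)) x)]].
Proof.
pose c := (n * d)%N.
have c0 : (0 < c)%N by rewrite muln_gt0 hn.
pose H := ((d ^ n).+1 * block_count n c)%N.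
pose s := (c + H)%N.
have Hs : (H <= s)%N by exact: leq_addl.
have [|P [Plc Psep Pcov]] := @clopen_marker n s; first by rewrite /s addn_gt0 c0.
pose L := lattice_points d c (n * s) P.
have hit i x : free_part n x ->
    exists2 a, (a < H)%N & L (bshift (basis_vec i *+ a) x).
  by move=> Fx; apply: lattice_points_axis c0 _ Psep Pcov Fx; exact: leqnn.
exists s, (free_part n `&` L); split.
- split; first by rewrite /s addn_gt0 c0.
  by apply: leq_trans (leq_addr _ _); rewrite leq_pmull.
- split; first exact: subIsetl.
  apply: locally_constant_clopen => x Fx.
  have [k kP] := lattice_points_locally_constant d c (n * s) Plc Fx.
  exists k => y Fy /(kP y Fy) eL.
  by apply/propext; split=> -[_ Lx]; split=> //; move: Lx; rewrite /L eL.
- move=> x y [Fx Lx] [_ Ly] xy [h _ hxy].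
  move: Ly xy; rewrite -hxy rho_bshift // leqNgt => Ly xy.
  apply/negP => /(lattice_points_separated hd Lx Ly) h0; apply: xy.
  by rewrite h0 bshift0.
- move=> i x Fx; have [a aH La] := hit i x Fx.
  (* A point of M behind x is found by searching forward from H steps behind. *)
  have [b bH Lb] := hit i _ (free_part_shift (g := - (basis_vec i *+ H)) Fx).
  exists a, (H - b)%N; split.
  + by apply: leq_trans Hs; exact: ltnW.
  + by apply: leq_trans Hs; exact: leq_subr.
  + by split=> //; exact: free_part_shift.
  + split; first exact: free_part_shift.
    by rewrite -bshiftD in Lb; rewrite mulrnBr ?(ltnW bH) // opprB.
Qed.
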